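(* Let $\alpha>0$ and let $t_n$ be a sequence of natural numbers with $\lim_{n\to\infty}t_n=\lim_{n\to\infty}n^2/t_n=\infty$. Then $$\limsup_{n\to\infty}\max_{j\in[n]}\mathbb{P}^n_{id}\left(\left.\max_{0\le m\le t_n}|\Pi_m(j)-j|>\alpha\sqrt{\tfrac{t_n}{2}}\,\right|\,j\in A^{t_n}\right)\le 4\Psi(\alpha),$$ where $\Psi$ is the tail probability function of a standard normal random variable, $\Psi(x)=\mathbb{P}(N(0,1)\ge x)$.
   Context: The random-to-random insertions shuffle on a deck of $n$ cards numbered $1,\dots,n$: at each step a card is chosen uniformly at random, removed, and reinserted at a uniformly random position. Orderings are identified with $\sigma\in S_n$, $\sigma(j)$ being the position of card $j$; $\Pi_t$ is the induced random walk on $S_n$ and $\mathbb{P}^n_{id}$ its law started at the identity. $A^t$ denotes the (random) set of cards that have not been chosen for removal in the first $t$ shuffles. $[n]=\{1,\dots,n\}$. *)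

(* Defs.v *)
From HB Require Import structures.
From mathcomp Require Import all_boot all_order all_algebra.
From mathcomp Require Import all_classical all_reals all_analysis.
Set Implicit Arguments. Unset Strict Implicit. Unset Printing Implicit Defensive.
Import Order.TTheory GRing.Theory Num.Theory.
Local Open Scope classical_set_scope.
Local Open Scope ring_scope.

(* Cards are 'I_n (0-indexed), positions are nat (0-indexed, in [0,n)).
   A deck state is sigma : 'I_n -> nat, sigma j = position of card j. *)

(* One random-to-random move: card c (at position r = sigma c) is removed
   and reinserted so that it ends at position p. *)
Definition rtr_step (n : nat) (cp : 'I_n * 'I_n) (sigma : 'I_n -> nat)
  : 'I_n -> nat :=
  fun k =>
    let c := cp.1 in let p := val cp.2 in let r := sigma c in
    if k == c then p
    else
      let q := sigma k in
      let q' := if (r < q)%N then q.-1 else q in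
      if (p <= q')%N then q'.+1 else q'.

Definition id_deck (n : nat) : 'I_n -> nat := fun j => val j.

Definition deck_after (n : nat) (s : seq ('I_n * 'I_n)) : 'I_n -> nat :=
  foldl (fun sigma cp => rtr_step cp sigma) (@id_deck n) s.

Definition Pi (n t : nat) (w : t.-tuple ('I_n * 'I_n)) (m : nat) : 'I_n -> nat :=
  deck_after (take m w).

Definition in_A (n t : nat) (w : t.-tuple ('I_n * 'I_n)) (j : 'I_n) : bool :=
  all (fun cp => cp.1 != j) w.

Definition Prob (R : realType) (n t : nat) (E : pred (t.-tuple ('I_n * 'I_n))) : R :=
  #|[set w | E w]|%:R / #|{: t.-tuple ('I_n * 'I_n)}|%:R.

Definition CondProb (R : realType) (n t : nat) (E C : pred (t.-tuple ('I_n * 'I_n))) : R :=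
  Prob R (fun w => E w && C w) / Prob R C.

Definition big_disp {R : realType} (n t : nat) (alpha : R) (j : 'I_n)
  (w : t.-tuple ('I_n * 'I_n)) : bool :=
  [exists m : 'I_t.+1,
     alpha * Num.sqrt (t%:R / 2) < `| (Pi w m j)%:R - (val j)%:R : R |].

Definition max_cond_prob (R : realType) (n t : nat) (alpha : R) : R :=
  \big[Num.max/0]_(j < n) CondProb R (@big_disp R n t alpha j) (fun w => @in_A n t w j).

Definition Psi {R : realType} (x : R) : R :=
  fine (normal_prob 0 1 `[x, +oo[).

(* Main.v *)
Require Import Defs.
From HB Require Import structures.
From mathcomp Require Import all_boot all_order all_algebra.
From mathcomp Require Import all_classical all_reals all_analysis.
From mathcomp Require Import measurable_realfun.
From mathcomp Require Import zify ring lra.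
Set Implicit Arguments. Unset Strict Implicit. Unset Printing Implicit Defensive.
Import Order.TTheory GRing.Theory Num.Theory.
Import numFieldNormedType.Exports.
Local Open Scope classical_set_scope.
Local Open Scope ring_scope.

(* Given that card j is never chosen, its position is a birth-death chain whose
   up and down probabilities are at most 1/4 + O(1/n) and differ by at most 1/n.
   Over t << n^2 steps the drift contributes at most t/n = o(sqrt t), so the
   displacement is dominated by a Brownian motion of variance t/2, whose
   probability of leaving [-a, a] before time t is at most 4 * Psi (a / sqrt (t/2))
   by the reflection principle. The comparison is a Lindeberg-type argument: the
   two-sided reflection bound, as a function of displacement and remaining time,
   solves the heat equation, and by a Taylor expansion of Psi it is an approximate
   supermartingale for the chain, with a total error that vanishes as n grows. *)

(** * The Gaussian tail [Psi] and its derivatives *)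

Section GaussianTail.
Variable R : realType.
Notation mu := (@lebesgue_measure R).
Notation phi := (@normal_pdf R 0 1).
Notation K := (@normal_peak R 1).

Lemma normal_pdf01E (x : R) : phi x = K * expR (- x ^+ 2 / 2).
Proof.
by rewrite normal_pdfE ?oner_eq0// /normal_fun subr0 expr1n.
Qed.

Lemma Psi_ge0 (x : R) : 0 <= Psi x.
Proof. exact/fine_ge0/measure_ge0. Qed.

Lemma Psi0 : Psi (0 : R) = 1 / 2.
Proof.
have c := @continuous_normal_pdf R 0 1 (oner_neq0 R).
have e : phi =1 phi \o -%R.
  by move=> x; rewrite /= !normal_pdf01E sqrrN.
have := ge0_symfun_integralT (fun x => normal_pdf_ge0 0 1 x) c e.
rewrite integral_normal_pdf -set_itvcy => /(congr1 fine) /=.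
rewrite fineM//; last first.
  exact: (fin_num_measure (normal_prob 0 1)).
rewrite -/(normal_prob 0 1 `[0, +oo[) -/(Psi 0) /=; lra.
Qed.

(** This puts the tail in a form with a variable upper limit, which the fundamental theorem of
    calculus can differentiate. *)
Lemma PsiE (x : R) : Psi x = 1 - \int[mu]_(t in `]-oo, x]) phi t.
Proof.
have mA : measurable (`[x, +oo[ : set R) by [].
have h := probability_setC (normal_prob 0 1) mA.
rewrite setCitvr in h.
rewrite /Rintegral -integral_itv_bndo_bndc; last first.
  by apply/measurable_EFinP/measurable_funTS; exact: measurable_normal_pdf.
rewrite -/(normal_prob 0 1 `]-oo, x[) h.
rewrite fineB// ?fin_num_measure//=.
rewrite /Psi; ring.
Qed.

Lemma is_derive_Psi (x : R) : is_derive x 1 Psi (- phi x).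
Proof.
have xx1 : x < x + 1 by rewrite ltrDl.
have int : mu.-integrable [set` Interval -oo%O (BRight (x + 1))] (EFin \o phi).
  by apply: integrableS (integrable_normal_pdf 0 1).
have /= [d e] := continuous_FTC1 xx1 int (ltNyr x)
  (@continuous_normal_pdf R 0 1 (oner_neq0 R) x).
set F := fun y => _ in d e.
have -> : Psi = cst 1 - F by apply/funext => z; exact: PsiE.
clearbody F; rewrite derive1E in e.
have dF : is_derive x 1 F (phi x) := DeriveDef d e.
by have := is_deriveB (is_derive_cst (1 : R) x 1) dF; rewrite sub0r.
Qed.

Lemma is_derive_normal_pdf (x : R) : is_derive x 1 phi (- (x * phi x)).
Proof.
have -> : phi = (fun x : R => K * expR (- x ^+ 2 / 2)).
  by apply/funext => z; exact: normal_pdf01E.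
by apply: is_derive_eq; rewrite /GRing.scale /=; field.
Qed.

Lemma is_derive_x_normal_pdf (x : R) :
  is_derive x 1 (fun z => z * phi z) ((1 - x ^+ 2) * phi x).
Proof.
have := is_derive_normal_pdf x => ?.
apply: is_derive_eq; rewrite /GRing.scale /=; ring.
Qed.

(** Bounds the third derivative of [Psi]: |1 - x^2| <= 2 (1 + x^2 / 2) <= 2 exp (x^2 / 2), and the
    exponential cancels the one in the density. *)
Lemma normal_pdf_gauss_bound (x : R) : `|(1 - x ^+ 2) * phi x| <= 2 * K.
Proof.
rewrite normrM (ger0_norm (normal_pdf_ge0 _ _ _)) normal_pdf01E mulrCA.
rewrite mulrC ler_wpM2r// ?normal_peak_ge0//.
have := expR_ge1Dx (x ^+ 2 / 2); rewrite mulNr expRN.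
set E := expR _ => hE.
have E0 : 0 < E by exact: expR_gt0.
rewrite ler_pdivrMr//; have := sqr_ge0 x; case: (ger0P (1 - x ^+ 2)) => ?; lra.
Qed.

End GaussianTail.

(** * Mean value estimates and Taylor expansion of [Psi] *)

Lemma MVT_at (R : realType) (f df : R -> R) (a b : R) :
  (forall x : R, is_derive x 1 f (df x)) ->
  exists2 c, Num.min a b <= c <= Num.max a b & f b - f a = df c * (b - a).
Proof.
move=> h; wlog ab : a b / a <= b.
  move=> W; have [/W//|] := boolP (a <= b).
  rewrite -ltNge => /ltW/W[c hc e].
  by exists c; [rewrite minC maxC|rewrite -opprB e; ring].
have cf : {within `[a, b], continuous f}.
  apply: continuous_subspaceT => x.
  by apply/differentiable_continuous/derivable1_diffP; case: (h x).
have [c /itvP hc e] := MVT_segment ab (fun x _ => h x) cf.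
by exists c => //; rewrite (min_idPl ab) (max_idPr ab) !hc.
Qed.

(** The mean value theorem between 0 and [x] gains one power of |x| and leaves the constant
    unchanged, so that the bound can be iterated. *)
Lemma primitive_bound (R : realType) (f df : R -> R) (C : R) (k : nat) :
  0 <= C -> f 0 = 0 -> (forall x : R, is_derive x 1 f (df x)) ->
  (forall x, `|df x| <= C * `|x| ^+ k) -> forall x, `|f x| <= C * `|x| ^+ k.+1.
Proof.
move=> C0 f0 h hb x; have [c hc e] := @MVT_at R f df 0 x h.
rewrite f0 !subr0 in e; rewrite e normrM exprSr mulrA ler_wpM2r//.
apply: le_trans (hb c) _; rewrite ler_wpM2l// lerXn2r ?nnegrE//.
move: hc; case: (lerP 0 x) => hx /andP[h1 h2].
  by rewrite !ger0_norm.
by rewrite !ler0_norm ?lerN2// ltW.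
Qed.

Section GaussianTaylor.
Variable R : realType.
Notation phi := (@normal_pdf R 0 1).
Notation K := (@normal_peak R 1).

(** The remainder [f0] and its derivatives [f1] and [f2] all vanish at 0, so the bound on the third
    derivative is carried up by three uses of [primitive_bound]. *)
Lemma Psi_taylor (y z : R) :
  `|Psi (y + z) - Psi y + phi y * z - y * phi y * z ^+ 2 / 2|
    <= 2 * K * `|z| ^+ 3.
Proof.
have K0 : 0 <= 2 * K by rewrite mulr_ge0// normal_peak_ge0.
pose f2 z := (y + z) * phi (y + z) - y * phi y.
pose f1 z := - phi (y + z) + phi y - y * phi y * z.
pose f0 z := Psi (y + z) - Psi y + phi y * z - y * phi y * z ^+ 2 / 2.
have hs (g dg : R -> R) : (forall x : R, is_derive x 1 g (dg x)) ->
    forall x : R, is_derive x 1 (fun z => g (y + z)) (dg (y + x)).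
  move=> h x; have hx := h (y + x).
  have hi : is_derive x 1 (fun z : R => y + z) 1 by have := is_deriveD (is_derive_cst y x 1) (is_derive_id x 1); rewrite add0r.
  have := @is_derive1_comp R g (fun z => y + z) x _ _ hx hi.
  by rewrite mulr1.
have h2 (x : R) : is_derive x 1 f2 ((1 - (y + x) ^+ 2) * phi (y + x)).
  have := hs _ _ (@is_derive_x_normal_pdf R) x => ?.
  by apply: is_derive_eq; rewrite subr0.
have h1 (x : R) : is_derive x 1 f1 (f2 x).
  have := hs _ _ (@is_derive_normal_pdf R) x => ?.
  by apply: is_derive_eq; rewrite /f2 /GRing.scale /=; ring.
have h0 (x : R) : is_derive x 1 f0 (f1 x).
  have := hs _ _ (@is_derive_Psi R) x => ?.
  by apply: is_derive_eq; rewrite /f1 /GRing.scale /=; field.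
apply: (@primitive_bound R f0 f1 _ 2 K0 _ h0).
  by rewrite /f0 addr0; ring.
apply: (@primitive_bound R f1 f2 _ 1 K0 _ h1).
  by rewrite /f1 addr0; ring.
apply: (@primitive_bound R f2 _ _ 0 K0 _ h2).
  by rewrite /f2 addr0 subrr.
by move=> x; rewrite expr0 mulr1 normal_pdf_gauss_bound.
Qed.

Lemma Psi_lipschitz (y z : R) : `|Psi y - Psi z| <= K * `|y - z|.
Proof.
have [c _ ->] := @MVT_at R Psi _ z y (@is_derive_Psi R).
rewrite normrM normrN (ger0_norm (normal_pdf_ge0 _ _ _)).
by apply: ler_wpM2r => //; apply: normal_pdf_ub; exact: oner_neq0.
Qed.

Lemma Psi_ge_half (y : R) : y <= 0 -> 1 / 2 <= Psi y.
Proof.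
move=> y0; have [c _ e] := @MVT_at R Psi _ y 0 (@is_derive_Psi R).
rewrite -Psi0 -subr_le0 e sub0r mulNr oppr_le0 mulr_ge0 ?normal_pdf_ge0//; lra.
Qed.

(* Psi is convex on the positive half-line. *)
Lemma Psi_tangent (y z : R) : 0 <= z -> z <= y ->
  phi y * (y - z) <= Psi z - Psi y.
Proof.
move=> z0 zy; have [c hc e] := @MVT_at R Psi _ y z (@is_derive_Psi R).
rewrite e mulNr -mulrN opprB ler_wpM2r ?subr_ge0// !normal_pdf01E.
move: hc; rewrite minC maxC (min_idPl zy) (max_idPr zy) => /andP[zc cy].
rewrite ler_wpM2l ?normal_peak_ge0// ler_expR !mulNr lerN2 ler_wpM2r//.
by rewrite lerXn2r ?nnegrE//; lra.
Qed.
End GaussianTaylor.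

(** * The reflection bound as an approximate supermartingale *)

Section HeatPotential.
Variable R : realType.
Notation K := (@normal_peak R 1).

(** Here [b] is the distance to a barrier, which an up-step shortens. In the Taylor expansion the
    first-order terms leave only the drift [pu - pd]. The second-order term is [phi (b * r) * b]
    times r^3 (pu + pd) / 2, hence at most [phi (b * r) * b * (r - r')], which convexity bounds by
    the gain from [Psi (b * r)] to [Psi (b * r')]. The third-order remainders give the last error
    term. *)
Lemma Psi_heat_step (pu pd b r r' : R) :
  0 <= pu -> 0 <= pd -> 0 <= b -> 0 <= r' -> r' <= r ->
  r ^+ 3 * ((pu + pd) / 2) <= r - r' ->
  pu * Psi ((b - 1) * r) + pd * Psi ((b + 1) * r) + (1 - pu - pd) * Psi (b * r)
    <= Psi (b * r') + `|pu - pd| * K * r + (pu + pd) * (2 * K) * r ^+ 3.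
Proof.
move=> pu0 pd0 b0 r'0 r'r hr.
have r0 : 0 <= r by lra.
set F := @normal_pdf R 0 1 (b * r).
have F0 : 0 <= F := normal_pdf_ge0 _ _ _.
have FK : F <= K by apply: normal_pdf_ub; exact: oner_neq0.
have := @Psi_taylor R (b * r) (- r); have := @Psi_taylor R (b * r) r.
rewrite normrN (ger0_norm r0) -/F => /ler_normlP[_ t1] /ler_normlP[_ t2].
rewrite (_ : (b - 1) * r = b * r - r); last by ring.
rewrite (_ : (b + 1) * r = b * r + r); last by ring.
have tg : F * (b * r - b * r') <= Psi (b * r') - Psi (b * r).
  by apply: Psi_tangent; [exact: mulr_ge0|exact: ler_wpM2l].
have t1' := ler_wpM2l pd0 t1; have t2' := ler_wpM2l pu0 t2.
have hb := ler_wpM2l (mulr_ge0 F0 b0) hr.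
have hd : (pu - pd) * F * r <= `|pu - pd| * K * r.
  apply: ler_wpM2r => //; apply: le_trans (ler_wpM2l (normr_ge0 _) FK).
  by apply: ler_wpM2r => //; exact: ler_norm.
move: (Psi (b * r)) (Psi (b * r')) (Psi (b * r - r)) (Psi (b * r + r)) tg t1' t2' hb hd.
move=> P0 P1 P2 P3; set Q := `|_| * K * r; lra.
Qed.

(* By the reflection principle, 2 * Psi ((a - x) * r) is the probability that
   a Brownian motion started at x and run up to variance r^-2 exceeds a; the
   second summand is the same for the lower barrier - a. *)
Definition exit_potential (a r x : R) : R :=
  2 * Psi ((a - x) * r) + 2 * Psi ((a + x) * r).

Lemma exit_potential_ge0 (a r x : R) : 0 <= exit_potential a r x.
Proof. by rewrite addr_ge0// mulr_ge0// Psi_ge0. Qed.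

(** Beyond a barrier the corresponding argument of [Psi] is nonpositive, so twice its value is at
    least 1. *)
Lemma exit_potential_ge1 (a r x : R) :
  0 <= r -> a < `|x| -> 1 <= exit_potential a r x.
Proof.
move=> r0; rewrite ltr_normr /exit_potential => /orP[ax|ax].
  have := @Psi_ge_half R ((a - x) * r) _; have := Psi_ge0 ((a + x) * r).
  rewrite mulr_le0_ge0 ?subr_le0 ?(ltW ax)// => ? /(_ isT); lra.
have := @Psi_ge_half R ((a + x) * r) _; have := Psi_ge0 ((a - x) * r).
rewrite mulr_le0_ge0//; last lra.
move=> ? /(_ isT); lra.
Qed.

(** [Psi_heat_step] is applied to each barrier, with the roles of up and down exchanged for the
    lower one; |x| <= a makes both distances nonnegative. *)
Lemma exit_potential_step (a pu pd r r' x e : R) :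
  0 <= pu -> 0 <= pd -> `|x| <= a -> 0 <= r' -> r' <= r ->
  r ^+ 3 * ((pu + pd) / 2) <= r - r' ->
  4 * K * (`|pu - pd| * r + 2 * (pu + pd) * r ^+ 3) <= e ->
  pu * exit_potential a r (x + 1) + pd * exit_potential a r (x - 1)
    + (1 - pu - pd) * exit_potential a r x <= exit_potential a r' x + e.
Proof.
move=> pu0 pd0 /ler_normlP[xa ax] r'0 r'r hr he.
have h1 := @Psi_heat_step pu pd (a - x) r r' pu0 pd0 _ r'0 r'r hr.
have h2 := @Psi_heat_step pd pu (a + x) r r' pd0 pu0 _ r'0 r'r _.
move: h1 h2; rewrite (addrC pd) => /(_ _)-/(_ ltac:(lra)) h1.
move=> /(_ ltac:(lra) hr); rewrite (distrC pd) => h2.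
rewrite /exit_potential.
rewrite (_ : a - (x + 1) = a - x - 1); last by ring.
rewrite (_ : a + (x + 1) = a + x + 1); last by ring.
rewrite (_ : a - (x - 1) = a - x + 1); last by ring.
rewrite (_ : a + (x - 1) = a + x - 1); last by ring.
lra.
Qed.
End HeatPotential.

(** * Counting move sequences that avoid a card *)

Section Counting.
Variables (R : realType) (n : nat).
Implicit Types (sigma : 'I_n -> nat) (j : 'I_n) (s : seq ('I_n * 'I_n)).

(** States are plain functions into [nat]; this invariant recovers that they are permutations of the
    positions. *)
Definition is_deck sigma := injective sigma /\ (forall k, (sigma k < n)%N).

Lemma is_deck_id : is_deck (@id_deck n).
Proof. by split => [x y /val_inj|k]. Qed.

Lemma is_deck_rtr_step cp sigma : is_deck sigma -> is_deck (rtr_step cp sigma).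
Proof.
case: cp => c p [inj ltn]; split => [x y|x]; rewrite /rtr_step /=; last first.
  have := ltn x; have := ltn c; have := ltn_ord p.
  have : x != c -> sigma x != sigma c by rewrite (inj_eq inj).
  case: (x == c) => //= /(_ isT) ? ? ? ?; case: (ltnP (sigma c) (sigma x)) => ?; case: ifP => ?; lia.
have hx : x != c -> sigma x != sigma c by rewrite (inj_eq inj).
have hy : y != c -> sigma y != sigma c by rewrite (inj_eq inj).
case: eqVneq hx => [-> _|_ /(_ isT) hx]; case: eqVneq hy => [-> _|_ /(_ isT) hy] //.
- by case: (ltnP (sigma c) (sigma y)) => ?; case: ifP => ? ?; exfalso; lia.
- by case: (ltnP (sigma c) (sigma x)) => ?; case: ifP => ? ?; exfalso; lia.
- by case: (ltnP (sigma c) (sigma x)) => ?; case: (ltnP (sigma c) (sigma y)) => ?;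
    case: ifP => ?; case: ifP => ? ?; apply: inj; lia.
Qed.

Lemma sum_if_lt (q : nat) (A B : R) : (q <= n)%N ->
  \sum_(r < n) (if (r < q)%N then A else B) = q%:R * A + (n - q)%:R * B.
Proof.
move=> qn; rewrite -(big_mkord xpredT (fun r => if (r < q)%N then A else B)).
rewrite (@big_cat_nat _ _ _ q)//=; congr (_ + _).
  rewrite (eq_big_nat _ _ (F2 := fun=> A)) => [|i /andP[_ ->]//].
  by rewrite sumr_const_nat subn0 mulr_natl.
rewrite (eq_big_nat _ _ (F2 := fun=> B)) => [|i /andP[]]; last by rewrite leqNgt => /negbTE->.
by rewrite sumr_const_nat mulr_natl.
Qed.

(** Each of the [q] cards before [j] moves it to [q.-1] on removal, and [q] of the insertion places
    push it back. Each of the n - q - 1 cards after [j] leaves it at [q] on removal, and q + 1 of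
    the places push it to [q.+1]. *)
Lemma sum_rtr_step sigma j (f : nat -> R) : is_deck sigma ->
  let q := sigma j in
  \sum_(cp : 'I_n * 'I_n | cp.1 != j) f (rtr_step cp sigma j) =
    q%:R * (q%:R * f q + (n - q)%:R * f q.-1)
    + (n - q.+1)%:R * (q.+1%:R * f q.+1 + (n - q.+1)%:R * f q).
Proof.
move=> [inj ltn] q; have qn : (q < n)%N := ltn j.
set A := _ + _ * f q.-1; set B := (_ + _ * f q).
pose G (r : nat) := \sum_(p < n)
  f (let q' := if (r < q)%N then q.-1 else q in if (p <= q')%N then q'.+1 else q').
have GE r : G r = if (r < q)%N then A else B.
  rewrite /G; case: ifP => rq; last first.
    rewrite /B -(@sum_if_lt q.+1 (f q.+1) (f q))//.
    by apply: eq_bigr => p _; rewrite ltnS; case: ifP.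
  rewrite /A -(@sum_if_lt q (f q) (f q.-1)) ?(ltnW qn)//.
  apply: eq_bigr => p _; rewrite (_ : (p <= q.-1)%N = (p < q)%N); last lia.
  by case: ifP => // _; rewrite prednK// (leq_ltn_trans _ rq).
pose s c : 'I_n := Ordinal (ltn c).
have sinj : injective s by move=> x y /(congr1 val)/inj.
transitivity (\sum_(c | c != j) G (sigma c)).
  rewrite (eq_bigl (fun cp => (cp.1 != j) && true)); last by move=> cp; rewrite andbT.
  rewrite -(pair_big (fun c => c != j) xpredT (fun c p => f (rtr_step (c, p) sigma j))).
  by apply: eq_bigr => c cj; apply: eq_bigr => p _; rewrite /rtr_step /= eq_sym (negbTE cj).
(* A deck is a bijection, so the sum over chosen cards becomes a sum over their positions. *)
transitivity (\sum_(r < n | r != s j) G r).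
  by rewrite [RHS](reindex_inj sinj); apply: eq_bigl => c; rewrite (inj_eq sinj).
(* The full sum also contains the excluded position r = q; it falls in the second case, so its term
   [B] cancels on both sides. *)
have : \sum_(r < n) G r = q%:R * A + (n - q)%:R * B.
  by rewrite -(@sum_if_lt q A B (ltnW qn)); apply: eq_bigr => r _; exact: GE.
rewrite (bigD1 (s j)) //= GE ltnn -[in RHS](subnSK qn) -natr1 => e.
apply: (@addrI _ B); rewrite e; ring.
Qed.

Lemma big_tuple_cons (T : finType) (k : nat) (P : pred (seq T)) :
  (\sum_(w : k.+1.-tuple T | P w) 1 = 
     \sum_(x : T) \sum_(w : k.-tuple T | P (x :: w)) 1 :> R).
Proof.
rewrite pair_big_dep /=.
rewrite (reindex (fun u : T * k.-tuple T => cons_tuple u.1 u.2)) //=.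
exists (fun w => (thead w, [tuple of behead w])) => [[x w] _|w _] /=.
  by congr pair; apply/val_inj.
by rewrite [w in RHS]tuple_eta; apply/val_inj.
Qed.

(** The exit event is defined by recursion on the first move, so that it can be bounded by
    first-step analysis. *)
Fixpoint exits (a x0 : R) j sigma s : bool :=
  (a < `|(sigma j)%:R - x0|) ||
  (if s is cp :: s' then exits a x0 j (rtr_step cp sigma) s' else false).

Lemma exitsP (a x0 : R) j sigma s :
  reflect (exists2 m, (m <= size s)%N &
             a < `|(foldl (fun tau cp => rtr_step cp tau) sigma (take m s) j)%:R - x0|)
          (exits a x0 j sigma s).
Proof.
apply: (iffP idP).
  elim: s sigma => [|cp s IH] sigma /=.
    by rewrite orbF => h; exists 0.
  case/orP => [h|/IH[m hm h]]; first by exists 0.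
  by exists m.+1.
case=> m; elim: s sigma m => [|cp s IH] sigma m /=.
  by move=> _ ->.
case: m => [_ /= -> //|m hm /= h]; apply/orP; right; exact: IH hm h.
Qed.

Definition avoids j s := all (fun cp : 'I_n * 'I_n => cp.1 != j) s.

Lemma sum_avoids j (k : nat) :
  \sum_(w : k.-tuple ('I_n * 'I_n) | avoids j w) 1 = (n.-1 * n)%:R ^+ k :> R.
Proof.
elim: k => [|k IH].
  rewrite (eq_bigl xpredT) => [|w]; last by rewrite [w]tuple0.
  by rewrite sumr_const card_tuple expn0 expr0.
rewrite big_tuple_cons (bigID (fun cp => cp.1 != j)) /= [X in _ + X]big1 => [|cp h]; last first.
  by rewrite big_pred0// => w; rewrite (negbTE h).
rewrite addr0 (eq_bigr (fun=> (n.-1 * n)%:R ^+ k)) => [|cp h]; last first.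
  by rewrite -IH; apply: eq_bigl => w; rewrite h.
rewrite exprS sumr_const -[LHS]mulr_natl; congr (_%:R * _).
rewrite (eq_card (B := [predX (predC1 j) & 'I_n])) => [|cp]; last by rewrite !inE andbT.
by rewrite cardX cardC1 !card_ord.
Qed.

Lemma sum_avoiding_le (P : pred (seq ('I_n * 'I_n))) j (k : nat) :
  \sum_(w : k.-tuple ('I_n * 'I_n) | P w && avoids j w) 1
    <= (n.-1 * n)%:R ^+ k :> R.
Proof.
rewrite -(sum_avoids j) [leRHS](bigID (fun w : k.-tuple _ => P w)) /=.
by under eq_bigl do rewrite andbC; rewrite lerDl sumr_ge0.
Qed.

(* U k x is a supermartingale bound, up to e per step, for the probability of
   leaving [-a, a] within k steps from displacement x. *)
Lemma sum_exits_le (a x0 e : R) j (U : nat -> R -> R) :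
  0 <= e -> (forall k x, 0 <= U k x) -> (forall k x, a < `|x| -> 1 <= U k x) ->
  (forall k (q : nat), (q < n)%N -> `|q%:R - x0| <= a ->
    q%:R * (q%:R * U k (q%:R - x0) + (n - q)%:R * U k (q%:R - x0 - 1))
    + (n - q.+1)%:R * (q.+1%:R * U k (q%:R - x0 + 1) + (n - q.+1)%:R * U k (q%:R - x0))
     <= (n.-1 * n)%:R * (U k.+1 (q%:R - x0) + e)) ->
  forall k sigma, is_deck sigma ->
  \sum_(w : k.-tuple ('I_n * 'I_n) | exits a x0 j sigma w && avoids j w) 1
    <= (n.-1 * n)%:R ^+ k * (U k ((sigma j)%:R - x0) + k%:R * e).
Proof.
move=> e0 U0 U1 UE k.
(* Once outside, the trivial count of all avoiding sequences suffices, because the potential is at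
   least 1 there. *)
have out k' sigma : a < `|(sigma j)%:R - x0| ->
    \sum_(w : k'.-tuple ('I_n * 'I_n) | exits a x0 j sigma w && avoids j w) 1
      <= (n.-1 * n)%:R ^+ k' * (U k' ((sigma j)%:R - x0) + k'%:R * e).
  move=> h; rewrite (le_trans (sum_avoiding_le (exits a x0 j sigma) _ _))//.
  by rewrite ler_peMr ?exprn_ge0// (le_trans (U1 k' _ h))// lerDl mulr_ge0.
elim: k => [|k IH] sigma deck.
all: have [|h] := boolP (a < `|(sigma j)%:R - x0|); first exact: out.
  rewrite expr0 mul1r mul0r addr0 big_pred0 => [|w]; first exact: U0.
  by rewrite [w]tuple0 /= (negbTE h).
rewrite (@big_tuple_cons _ k (fun s => exits a x0 j sigma s && avoids j s)).
rewrite (bigID (fun cp => cp.1 != j)) /= [X in _ + X]big1 => [|cp hc]; last first.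
  by rewrite big_pred0// => w; rewrite (negbTE hc) andbF.
rewrite addr0.
(* The induction hypothesis after the first move, as a function of the new position of [j]. *)
pose f (p : nat) := (n.-1 * n)%:R ^+ k * (U k (p%:R - x0) + k%:R * e).
apply: (@le_trans _ _ (\sum_(cp : 'I_n * 'I_n | cp.1 != j) f (rtr_step cp sigma j))).
  apply: ler_sum => cp hc; apply: le_trans (IH _ (is_deck_rtr_step cp deck)).
  by under eq_bigl do rewrite (negbTE h) hc.
rewrite sum_rtr_step//.
have := UE k (sigma j) (proj2 deck j).
rewrite -leNgt in h; move=> /(_ h); set q := sigma j in h *.
have qn : (q < n)%N := proj2 deck j.
(* At q = 0 the truncated [q.-1] differs from the real q - 1, but the factor [q] removes the
   term. *)
have -> : q%:R * (q%:R * f q + (n - q)%:R * f q.-1) =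
  q%:R * (q%:R * f q + (n - q)%:R * ((n.-1 * n)%:R ^+ k * (U k (q%:R - x0 - 1) + k%:R * e))).
  case: (q) => [|q']; first by rewrite !mul0r.
  by rewrite /f /= -natr1 (_ : q'%:R + 1 - x0 - 1 = q'%:R - x0); last by ring.
rewrite /f -!natr1 (_ : q%:R + 1 - x0 = q%:R - x0 + 1); last by ring.
have -> : (n - q)%:R = n%:R - q%:R :> R by rewrite natrB// ltnW.
have -> : (n - q.+1)%:R = n%:R - q%:R - 1 :> R by rewrite natrB// -natr1; ring.
have -> : (n.-1 * n)%:R = (n%:R - 1) * n%:R :> R.
  by rewrite natrM -subn1 natrB// (leq_ltn_trans _ qn).
rewrite exprS.
have : 0 <= ((n%:R - 1) * n%:R) ^+ k :> R.
  by apply/exprn_ge0/mulr_ge0 => //; rewrite subr_ge0 ler1n (leq_ltn_trans _ qn).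
move=> M0 /(ler_wpM2l M0); rewrite -subr_ge0 => hh; rewrite -subr_ge0.
by apply: le_trans hh _; rewrite le_eqVlt; apply/orP; left; apply/eqP; ring.
Qed.
End Counting.

(** * Transition rates and the bound for fixed deck size *)

Section CondProbBound.
Variable R : realType.
Notation K := (@normal_peak R 1).

Lemma CondProb_ge0 n t (E C : pred (t.-tuple ('I_n * 'I_n))) :
  0 <= CondProb R E C.
Proof. by rewrite /CondProb /Prob !divr_ge0. Qed.

Lemma CondProb_le1 n t (E C : pred (t.-tuple ('I_n * 'I_n))) :
  CondProb R E C <= 1.
Proof.
rewrite /CondProb /Prob.
set x := _%:R / _; set y := _%:R / _.
have xy : x <= y.
  rewrite ler_wpM2r ?invr_ge0// ler_nat; apply/subset_leq_card/fintype.subsetP => w.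
  by rewrite !inE => /andP[].
have y0 : 0 <= y by exact: divr_ge0.
have [->|yn0] := eqVneq y 0; first by rewrite invr0 mulr0.
by rewrite ler_pdivrMr ?mul1r// lt_def yn0.
Qed.

Lemma CondProbE n t (E C : pred (t.-tuple ('I_n * 'I_n))) : (0 < n)%N ->
  CondProb R E C = (\sum_(w | E w && C w) 1) / (\sum_(w | C w) 1).
Proof.
move=> n0; have hT : (#|{: t.-tuple ('I_n * 'I_n)}|%:R : R) != 0.
  by rewrite pnatr_eq0 card_tuple card_prod card_ord -lt0n expn_gt0 muln_gt0 n0.
rewrite /CondProb /Prob -mulf_div divff ?invr_eq0// mulr1.
have cE (P : pred (t.-tuple ('I_n * 'I_n))) : #|[set w | P w]| = #|P|.
  by apply: eq_card => w; apply/idP/idP; rewrite inE.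
by rewrite !cE !sumr_const.
Qed.

Lemma big_dispE n t (alpha : R) (j : 'I_n) (w : t.-tuple ('I_n * 'I_n)) :
  big_disp alpha j w =
  exits (alpha * Num.sqrt (t%:R / 2)) (val j)%:R j (@id_deck n) w.
Proof.
apply/existsP/exitsP => [[m h]|[m hm h]].
  by exists (val m); rewrite // size_tuple -ltnS ltn_ord.
rewrite size_tuple -ltnS in hm.
by exists (Ordinal hm).
Qed.

(** Since S' - S = d / (S' + S) >= d / (2 S'), the difference of inverses is at least d / (2 S
    S'^2), and the last hypothesis turns this into c / S^3. *)
Lemma inv_decrement_bound (d c S S' : R) : 0 < S -> 0 < S' -> 0 <= d ->
  S' ^+ 2 = S ^+ 2 + d -> c * S' ^+ 2 <= d / 2 * S ^+ 2 ->
  S^-1 ^+ 3 * c <= S^-1 - S'^-1.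
Proof.
move=> S0 S'0 d0 e hc.
have SS' : S <= S'.
  by rewrite -(@ler_pXn2r _ 2%N) ?nnegrE ?(ltW S0) ?(ltW S'0)// e lerDl.
have h : c * S' <= S ^+ 2 * (S' - S).
  have hd : d / 2 <= (S' - S) * S'.
    have -> : d = (S' - S) * (S' + S) by rewrite -subr_sqr e; ring.
    by rewrite -mulrA; apply: ler_wpM2l; [rewrite subr_ge0|lra].
  rewrite -(ler_pM2r S'0); have := ler_wpM2l (sqr_ge0 S) hd; lra.
have -> : S^-1 ^+ 3 * c = (c * S') / (S ^+ 3 * S').
  by field; rewrite !lt0r_neq0.
have -> : S^-1 - S'^-1 = (S ^+ 2 * (S' - S)) / (S ^+ 3 * S').
  by field; rewrite !lt0r_neq0.
by rewrite ler_wpM2r// invr_ge0 mulr_ge0 ?exprn_ge0// ltW.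
Qed.

(** With d = (1 + delta) / 2 and c = (1 + delta / 2) / 4, the margin d / 2 - c is delta / 8, while c
    d <= 3 / 8 as delta <= 1. So c v' <= d v / 2 follows from 3 <= delta v, which is where the
    threshold 6 comes from. *)
Lemma inv_sqrt_step (delta t v v' : R) :
  0 < delta -> delta <= 1 -> 6 <= delta ^+ 2 * t -> delta * t / 2 <= v ->
  v' = v + (1 + delta) / 2 ->
  (Num.sqrt v)^-1 ^+ 3 * ((1 + delta / 2) / 4)
    <= (Num.sqrt v)^-1 - (Num.sqrt v')^-1.
Proof.
move=> d0 d1 ht hv vE.
have h : 3 <= delta * v.
  have := ler_wpM2l (ltW d0) hv; lra.
have v0 : 0 < v by rewrite -(pmulr_rgt0 _ d0); lra.
have v'0 : 0 < v' by lra.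
apply: (@inv_decrement_bound ((1 + delta) / 2)); rewrite ?sqrtr_gt0//; first lra.
  by rewrite !sqr_sqrtr// ltW.
rewrite !sqr_sqrtr ?(ltW v0) ?(ltW v'0)// vE; nra.
Qed.

(** Transition probabilities of the position [q] of a card, in a deck of [N] cards, given that this
    card is not chosen. *)
Definition up_rate (N q : R) := (N - q - 1) * (q + 1) / ((N - 1) * N).
Definition down_rate (N q : R) := q * (N - q) / ((N - 1) * N).

Lemma rateE (N q A B C : R) : 1 < N ->
  q * (q * B + (N - q) * C) + (N - q - 1) * ((q + 1) * A + (N - q - 1) * B) =
  (N - 1) * N * (up_rate N q * A + down_rate N q * C
                 + (1 - up_rate N q - down_rate N q) * B).
Proof.
move=> N1; have N0 : 0 < N by lra.
have N10 : 0 < N - 1 by lra.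
by rewrite /up_rate /down_rate; field; rewrite !lt0r_neq0.
Qed.

Lemma rate_ge0 (N q : R) : 1 < N -> 0 <= q -> q + 1 <= N ->
  0 <= up_rate N q /\ 0 <= down_rate N q.
Proof.
move=> N1 q0 qN; have M0 : 0 <= (N - 1) * N by apply: mulr_ge0; lra.
by split; apply: divr_ge0 => //; apply: mulr_ge0; lra.
Qed.

(** Both numerators are at most N^2 / 4, so the half-sum is at most N / (4 (N - 1)). *)
Lemma rate_sum_le (N q delta : R) : 1 < N -> 2 + delta <= delta * N ->
  (up_rate N q + down_rate N q) / 2 <= (1 + delta / 2) / 4.
Proof.
move=> N1 hN; have M0 : 0 < (N - 1) * N by apply: mulr_gt0; lra.
rewrite /up_rate /down_rate -mulrDl mulrAC ler_pdivrMr//.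
have := sqr_ge0 (N - 2 * q - 2); have := sqr_ge0 (N - 2 * q).
have N0 : 0 <= N by lra.
have := ler_wpM2l N0 hN; nra.
Qed.

(** The quadratic terms cancel: the difference is (N - 1 - 2 q) / ((N - 1) N). *)
Lemma rate_diff_le (N q : R) : 1 < N -> 0 <= q -> q + 1 <= N ->
  `|up_rate N q - down_rate N q| <= N^-1.
Proof.
move=> N1 q0 qN; have N0 : 0 < N by lra.
have N10 : 0 < N - 1 by lra.
have -> : up_rate N q - down_rate N q = (N - 1 - 2 * q) / (N - 1) / N.
  by rewrite /up_rate /down_rate; field; rewrite !lt0r_neq0.
rewrite normrM (@ger0_norm _ N^-1) ?invr_ge0 ?(ltW N0)//.
rewrite ler_piMl ?invr_ge0 ?(ltW N0)//.
rewrite normrM [X in _ * X]ger0_norm ?invr_ge0 ?(ltW N10)//.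
by rewrite ler_pdivrMr// mul1r; apply/ler_normlP; split; lra.
Qed.

(** The bound before passing to the limit: the first term is the potential at the start, the second
    is [t] times the error of one step. [r0] is the largest inverse standard deviation, reached with
    no steps left. *)
Lemma max_cond_prob_le (n t : nat) (alpha delta r0 : R) :
  r0 = (Num.sqrt (delta * t%:R / 2))^-1 -> 0 <= alpha -> 0 < delta -> delta <= 1 ->
  2 + delta <= delta * n%:R -> 6 <= delta ^+ 2 * t%:R ->
  max_cond_prob n t alpha <= 4 * Psi (alpha / Num.sqrt (1 + 2 * delta))
    + t%:R * (4 * K * (r0 / n%:R + 2 * r0 ^+ 3)).
Proof.
move=> r0E al0 d0 d1 hn ht.
have nge : 2 <= n%:R :> R by move: hn d0 d1; nra.
have n2 : (2 <= n)%N by rewrite -(ler_nat R).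
have n0 : (0 < n)%N by exact: ltn_trans n2.
have d_half : 0 <= (1 + delta) / 2 by lra.
have d_quarter : (1 + delta / 2) / 4 * 2 <= 1 by lra.
have t0 : 0 < t%:R :> R.
  by rewrite -(pmulr_rgt0 _ (exprn_gt0 2 d0)); lra.
have K0 : 0 <= K := normal_peak_ge0 _.
(* The variance delta * t present at time 0 keeps the potential smooth there;
   the factor 1 + delta absorbs both the discretization of time and the excess
   of the step variance over 1/2. *)
pose v (k : nat) := ((1 + delta) * k%:R + delta * t%:R) / 2.
have vk k : delta * t%:R / 2 <= v k.
  by rewrite /v ler_pM2r// lerDr mulr_ge0//; lra.
have v0 : 0 < delta * t%:R / 2 by rewrite divr_gt0// mulr_gt0.
have vk0 k : 0 < v k := lt_le_trans v0 (vk k).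
pose r k := (Num.sqrt (v k))^-1.
have sv0 k : 0 < Num.sqrt (v k) by rewrite sqrtr_gt0.
have rk0 k : 0 < r k by rewrite invr_gt0.
have rr0 k : r k <= r0.
  by rewrite r0E lef_pV2 ?posrE ?sqrtr_gt0// ler_wsqrtr.
have r0_0 : 0 < r0 := lt_le_trans (rk0 0) (rr0 0).
pose e := 4 * K * (r0 / n%:R + 2 * r0 ^+ 3).
have e0 : 0 <= e.
  by rewrite !mulr_ge0// addr_ge0// ?divr_ge0 ?mulr_ge0 ?exprn_ge0// ltW.
pose a := alpha * Num.sqrt (t%:R / 2).
pose U k x := exit_potential a (r k) x.
apply: bigmax_le => [|j _].
  by apply: addr_ge0; apply: mulr_ge0 => //; exact: Psi_ge0.
rewrite CondProbE//.
have -> : \sum_(w : t.-tuple ('I_n * 'I_n) | in_A w j) 1 = (n.-1 * n)%:R ^+ t :> R.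
  exact: sum_avoids.
have N0 : 0 < (n.-1 * n)%:R :> R.
  by rewrite ltr0n muln_gt0 n0 andbT -subn1 subn_gt0.
rewrite ler_pdivrMr ?exprn_gt0// mulrC.
under eq_bigl do rewrite big_dispE.
have := @sum_exits_le R n a (val j)%:R e j U e0 _ _ _ t _ (@is_deck_id n).
rewrite /id_deck subrr.
(* At displacement 0 both barriers are at distance [a], hence the factor 4; the variance is v t = (1
   + 2 delta) t / 2. *)
have -> : U t 0 = 4 * Psi (alpha / Num.sqrt (1 + 2 * delta)).
  rewrite /U /exit_potential subr0 addr0.
  have -> : a * r t = alpha / Num.sqrt (1 + 2 * delta).
    rewrite /a /r (_ : v t = (1 + 2 * delta) * (t%:R / 2)); last by rewrite /v; field.
    rewrite [Num.sqrt (_ * (_ / _))]sqrtrM; last lra.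
    have : Num.sqrt (t%:R / 2 : R) != 0 by rewrite gt_eqF// sqrtr_gt0 divr_gt0.
    have : Num.sqrt (1 + 2 * delta) != 0 by rewrite gt_eqF// sqrtr_gt0; lra.
    move: (Num.sqrt _) (Num.sqrt _) => x y x0 y0; field; exact/andP.
  by ring.
apply => [k x|k x|k q qn hx].
- exact: exit_potential_ge0.
- by apply: exit_potential_ge1; exact: ltW.
have n1 : 1 < n%:R :> R by rewrite ltr1n.
have qn1 : q%:R + 1 <= n%:R :> R by rewrite natr1 ler_nat.
have [pu0 pd0] := rate_ge0 n1 (ler0n R q) qn1.
have -> : (n - q)%:R = n%:R - q%:R :> R by rewrite natrB// ltnW.
have -> : (n - q.+1)%:R = n%:R - q%:R - 1 :> R by rewrite natrB// -natr1; ring.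
have -> : (n.-1 * n)%:R = (n%:R - 1) * n%:R :> R.
  by rewrite natrM -subn1 natrB.
rewrite -natr1 rateE// ler_wpM2l ?mulr_ge0 ?subr_ge0 ?(ltW n1)//.
have vE : v k.+1 = v k + (1 + delta) / 2 by rewrite /v -natr1; field.
apply: exit_potential_step => //.
- exact: ltW.
- rewrite lef_pV2 ?posrE// ler_wsqrtr// vE lerDl; exact: d_half.
- apply: le_trans (inv_sqrt_step d0 d1 ht (vk k) vE).
  by rewrite ler_wpM2l ?rate_sum_le// exprn_ge0// ltW.
rewrite /e; apply: ler_wpM2l; first exact: mulr_ge0.
have r3 : r k ^+ 3 <= r0 ^+ 3 by rewrite lerXn2r ?nnegrE// ltW.
apply: lerD.
  by rewrite mulrC; apply: ler_pM => //; [exact: ltW|exact: rate_diff_le].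
apply: ler_pM => //; first by rewrite mulr_ge0// addr_ge0.
  by rewrite exprn_ge0// ltW.
(* What remains is that the two rates sum to at most 1. *)
rewrite -[leRHS]mulr1 ler_wpM2l//.
have := rate_sum_le q%:R n1 hn; move: (_ + _) => x.
by rewrite ler_pdivrMr// => /le_trans; apply; exact: d_quarter.
Qed.

End CondProbBound.

(** * Passage to the limit *)

Lemma limn_sup_le (R : realType) (u : nat -> R) (B : R) :
  bounded_fun u -> (\forall n \near \oo, u n <= B) -> limn_sup u <= B.
Proof.
move=> bu [N _ hN]; rewrite limn_supE//.
apply: le_trans (_ : sups u N <= B).
  by apply: ge_inf; [exact: bounded_fun_has_lbound_sups|exists N].
apply: ge_sup; first by exists (u N), N => //=.
by move=> _ [m /= Nm <-]; exact: hN.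
Qed.

(** After squaring, this is (1 - x)^2 (1 + 2 x) = 1 - x^2 (3 - 2 x) <= 1. *)
Lemma inv_sqrt_ge (R : realType) (x : R) :
  0 <= x -> x <= 1 -> 1 - x <= (Num.sqrt (1 + 2 * x))^-1.
Proof.
move=> x0 x1; have s0 : 0 < Num.sqrt (1 + 2 * x) by rewrite sqrtr_gt0; lra.
rewrite -[leRHS]mul1r ler_pdivlMr// -(@ler_pXn2r _ 2%N) ?nnegrE//; last first.
  by rewrite mulr_ge0 ?(ltW s0)//; lra.
by rewrite exprMn sqr_sqrtr; [nra|lra].
Qed.

Theorem theorem3 (R : realType) (alpha : R) (t : nat -> nat) :
  0 < alpha ->
  (fun n => (t n)%:R : R) @ \oo --> +oo ->
  (fun n => (n ^ 2)%:R / (t n)%:R : R) @ \oo --> +oo ->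
  limn_sup (fun n => max_cond_prob n (t n) alpha) <= 4 * Psi alpha.
Proof.
move=> al0 t_oo nt_oo.
have K0 : 0 < normal_peak (1 : R) by apply: normal_peak_gt0; exact: oner_neq0.
have bnd : bounded_fun (fun n => max_cond_prob n (t n) alpha).
  exists 1; split => // M M1 n _ /=.
  have h0 : 0 <= max_cond_prob n (t n) alpha by exact: bigmax_ge_id.
  rewrite ger0_norm//; apply: le_trans (ltW M1); apply: bigmax_le => // j _.
  exact: CondProb_le1.
apply/ler_addgt0Pr => eps eps0; apply: limn_sup_le bnd _.
set K := normal_peak 1 in K0.
(* Chosen so that replacing the argument of [Psi] by [alpha] costs at most 4 K alpha delta <= eps /
   2, [K] being a Lipschitz constant of [Psi]. *)
pose delta := Num.min 1 (eps / (8 * K * alpha)).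
have d0 : 0 < delta by rewrite lt_min ltr01 divr_gt0// !mulr_gt0.
have d1 : delta <= 1 by rewrite ge_min lexx.
have deps : delta * (8 * K * alpha) <= eps.
  by rewrite -ler_pdivlMr ?mulr_gt0// ge_min lexx orbT.
(* The total error will be (8 K / delta) (s / n + 2 / s), with s^2 = delta t / 2; if s / n and 1 / s
   are at most [eta], it is at most 3 eps / 8. *)
pose eta := eps * delta / (64 * K).
have eta0 : 0 < eta by rewrite divr_gt0 ?mulr_gt0.
have Psi_delta :
    4 * Psi (alpha / Num.sqrt (1 + 2 * delta)) <= 4 * Psi alpha + eps / 2.
  have := Psi_lipschitz (alpha / Num.sqrt (1 + 2 * delta)) alpha.
  rewrite -/K => /ler_normlP[_]; set P := Psi _; set Q := Psi alpha.
  have := inv_sqrt_ge (ltW d0) d1; set s := (Num.sqrt _)^-1 => hs h.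
  have s1 : s <= 1.
    rewrite invf_le1 ?sqrtr_gt0; last lra.
    by rewrite -[leLHS]sqrtr1 ler_wsqrtr//; lra.
  have : `|alpha * s - alpha| <= alpha * delta.
    rewrite ler0_norm; last by rewrite subr_le0 ler_piMr// ltW.
    by rewrite opprB -[X in X - _]mulr1 -mulrBr ler_wpM2l ?(ltW al0)//; lra.
  move=> /(ler_wpM2l (ltW K0)); lra.
near=> n.
have hn : 2 + delta <= delta * n%:R.
  rewrite mulrC -ler_pdivrMr//; near: n; exact: nbhs_infty_ger.
have ht : 6 / delta ^+ 2 <= (t n)%:R.
  by near: n; move/cvgryPge: t_oo; apply.
(* This threshold and the next one are the squared forms of 1 <= eta s and s <= eta n. *)
have ht' : 2 / delta / eta ^+ 2 <= (t n)%:R.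
  by near: n; move/cvgryPge: t_oo; apply.
have hnt : delta / 2 / eta ^+ 2 <= (n ^ 2)%:R / (t n)%:R.
  by near: n; move/cvgryPge: nt_oo; apply.
rewrite ler_pdivrMr ?exprn_gt0// mulrC in ht.
have t0 : 0 < (t n)%:R :> R.
  by rewrite -(pmulr_rgt0 _ (exprn_gt0 2 d0)); lra.
have n0 : 0 < n%:R :> R by rewrite -(pmulr_rgt0 _ d0); lra.
pose s := Num.sqrt (delta * (t n)%:R / 2).
apply: le_trans (max_cond_prob_le (erefl s^-1) (ltW al0) d0 d1 hn ht) _.
have s2 : s ^+ 2 = delta * (t n)%:R / 2.
  by rewrite sqr_sqrtr// divr_ge0// mulr_ge0// ltW.
have s0 : 0 < s by rewrite sqrtr_gt0 divr_gt0// mulr_gt0.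
have tE : (t n)%:R = 2 / delta * s ^+ 2 by rewrite s2; field; exact: lt0r_neq0.
have es : 1 <= eta * s.
  rewrite -(@ler_pXn2r _ 2%N) ?nnegrE ?(ltW (mulr_gt0 eta0 s0))//.
  rewrite expr1n exprMn s2; move: ht'.
  rewrite ler_pdivrMr ?exprn_gt0// ler_pdivrMr//; lra.
have en : s <= eta * n%:R.
  rewrite -(@ler_pXn2r _ 2%N) ?nnegrE ?(ltW s0) ?(ltW (mulr_gt0 eta0 n0))//.
  rewrite exprMn s2; move: hnt; rewrite ler_pdivrMr ?exprn_gt0//.
  rewrite natrX mulrAC ler_pdivlMr//; lra.
have err : (t n)%:R * (4 * K * (s^-1 / n%:R + 2 * s^-1 ^+ 3)) <= eps / 2.
  have -> : (t n)%:R * (4 * K * (s^-1 / n%:R + 2 * s^-1 ^+ 3)) =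
      8 * K / delta * (s / n%:R + 2 * s^-1).
    by rewrite tE; field; rewrite !lt0r_neq0.
  have h1 : s / n%:R <= eta by rewrite ler_pdivrMr.
  have h2 : s^-1 <= eta by rewrite -[leLHS]mul1r ler_pdivrMr.
  apply: le_trans (_ : 8 * K / delta * (3 * eta) <= _).
    by rewrite ler_wpM2l ?divr_ge0 ?mulr_ge0 ?(ltW K0) ?(ltW d0)//; lra.
  have -> : 8 * K / delta * (3 * eta) = eps * (3 / 8).
    by rewrite /eta; field; rewrite !lt0r_neq0.
  by rewrite ler_pM2l//; lra.
by rewrite (splitr eps) addrA; exact: lerD.
Unshelve. all: by end_near.
Qed.
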